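(* Let $(E,\|\cdot\|)$ be a normed linear space over $\mathbb{K}$ ($\mathbb{K}=\mathbb{R}$ or $\mathbb{C}$), let $n\ge1$ and let $\mathbf{x}=(x_1,\dots,x_n)\in E^n$. Then $$0\le\|\mathbf{x}\|_{h,e}^2-\frac1n\|\mathbf{x}\|_{h,n,1}^2\le\frac14 n\|\mathbf{x}\|_{n,\infty}^2,$$ $$0\le\|\mathbf{x}\|_{h,e}^2-\frac1n\|\mathbf{x}\|_{h,n,1}^2\le\|\mathbf{x}\|_{h,n,1}\|\mathbf{x}\|_{n,\infty}$$ and $$0\le\|\mathbf{x}\|_{h,e}-\frac{1}{\sqrt n}\|\mathbf{x}\|_{h,n,1}\le\frac14\sqrt n\,\|\mathbf{x}\|_{n,\infty}.$$
   Context: For $\mathbf{x}=(x_1,\dots,x_n)\in E^n$, $\|\mathbf{x}\|_{n,\infty}:=\max_{j}\|x_j\|$. The hypo-$1$-norm and the hypo-Euclidean norm of $\mathbf{x}\in E^n$ are $$\|\mathbf{x}\|_{h,n,1}:=\sup\left\{\left\|\sum_{j=1}^n\lambda_jx_j\right\| : \lambda\in\mathbb{K}^n,\ \max_j|\lambda_j|\le1\right\},$$ $$\|\mathbf{x}\|_{h,e}:=\sup\left\{\left\|\sum_{j=1}^n\lambda_jx_j\right\| : \lambda\in\mathbb{K}^n,\ \sum_{j=1}^n|\lambda_j|^2\le1\right\}.$$ *)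

(* Defs.v *)
From HB Require Import structures.
From mathcomp Require Import all_boot all_order all_algebra.
From mathcomp Require Import complex.
From mathcomp Require Import all_classical all_reals all_analysis.

Set Implicit Arguments.
Unset Strict Implicit.
Unset Printing Implicit Defensive.

Import Order.TTheory GRing.Theory Num.Theory.
Import numFieldNormedType.Exports.

Local Open Scope classical_set_scope.
Local Open Scope ring_scope.

Variant scalar_kind := RealScalars | ComplexScalars.

Definition scalar_field (R : realType) (k : scalar_kind) : numFieldType :=
  match k with
  | RealScalars => R : numFieldType
  | ComplexScalars => R[i] : numFieldType
  end.

Definition scalar_re (R : realType) (k : scalar_kind) : scalar_field R k -> R :=
  match k return scalar_field R k -> R with
  | RealScalars => fun a => a
  | ComplexScalars => fun a => complex.Re a
  end.

(* MathComp norms over a field K take their values in K, so over R[i] a norm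
   is a complex number with zero imaginary part; [rnorm] is the same norm read
   in R.  It applies to vectors and to the scalars themselves. *)
Definition rnorm (R : realType) (k : scalar_kind)
    (V : normedZmodType (scalar_field R k)) (v : V) : R :=
  scalar_re `|v|.

(* The default value 0 of the big max is harmless as the terms are >= 0. *)
Definition maxnorm (R : realType) (k : scalar_kind)
    (V : normedZmodType (scalar_field R k)) (n : nat) (x : 'I_n -> V) : R :=
  \big[Num.max/0]_(j < n) rnorm (x j).

(* In the next two definitions, the supremum is over a nonempty set which is
   bounded above (by the sum of the norms of the x j), so that the total
   operator [sup] is the true supremum. *)
Definition hypo1_norm (R : realType) (k : scalar_kind)
    (E : normedModType (scalar_field R k)) (n : nat) (x : 'I_n -> E) : R :=
  sup [set rnorm (\sum_(j < n) l j *: x j)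
      | l in [set l : 'I_n -> scalar_field R k | maxnorm l <= 1]].

Definition hypoE_norm (R : realType) (k : scalar_kind)
    (E : normedModType (scalar_field R k)) (n : nat) (x : 'I_n -> E) : R :=
  sup [set rnorm (\sum_(j < n) l j *: x j)
      | l in [set l : 'I_n -> scalar_field R k
             | \sum_(j < n) rnorm (l j) ^+ 2 <= 1]].

(* Main.v *)
Require Import Defs.
From HB Require Import structures.
From mathcomp Require Import all_boot all_order all_algebra.
From mathcomp Require Import complex.
From mathcomp Require Import all_classical all_reals all_analysis.
From mathcomp Require Import ring lra.

Set Implicit Arguments.
Unset Strict Implicit.
Unset Printing Implicit Defensive.

Import Order.TTheory GRing.Theory Num.Theory.
Import numFieldNormedType.Exports.

Local Open Scope classical_set_scope.
Local Open Scope ring_scope.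

(* Write H, h and M for the hypo-Euclidean, hypo-1 and max norms of x.
   Everything follows from h <= sqrt n * H (rescale the coefficients by
   1 / sqrt n) and H ^ 2 <= h * M, combined with AM-GM.  For the latter no
   duality is needed: truncating coefficients l with sum |l_j| ^ 2 <= 1 at
   level c leaves a remainder m with 4 * c * sum |m_j| <= sum |l_j| ^ 2, because
   4 * c * (t - c) <= t ^ 2.  Hence 4 * c * H <= 4 * c ^ 2 * h + M for all
   c >= 0, and c = H / (2 * h) gives the claim. *)

(** The embedding of [R] into the scalars, by cases on [k] because [scalar_field R k] reduces only
    once [k] is known. *)
Definition real_scalar (R : realType) (k : scalar_kind) : R -> scalar_field R k :=
  match k return R -> scalar_field R k with
  | RealScalars => fun a => a
  | ComplexScalars => fun a => a%:C%C
  end.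

(** * Real-valued norms, uniformly in the scalar field *)

Section RealNorm.
Variables (R : realType) (k : scalar_kind).
Local Notation K := (scalar_field R k).

Lemma rnorm_ge0 (V : normedZmodType K) (v : V) : 0 <= rnorm v.
Proof.
(* In [R[i]], [<=] means equal imaginary parts and ordered real parts, so inequalities between norms
   pass to [Re]. *)
rewrite /rnorm; have := normr_ge0 v; move: `|v|.
by case: k => //= -[a b]; rewrite lecE /= => /andP[].
Qed.

Lemma ler_rnormD (V : normedZmodType K) (v w : V) :
  rnorm (v + w) <= rnorm v + rnorm w.
Proof.
rewrite /rnorm; have := ler_normD v w; move: `|v| `|w| `|v + w|.
by case: k => //= -[a b] [c d] [e f]; rewrite lecE /= => /andP[].
Qed.

Lemma rnorm0 (V : normedZmodType K) : rnorm (0 : V) = 0.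
Proof. by rewrite /rnorm normr0; case: k. Qed.

Lemma rnorm_eq0 (V : normedZmodType K) (v : V) : rnorm v = 0 -> v = 0.
Proof.
move=> v0; apply/normr0_eq0; move: v0; rewrite /rnorm.
have := normr_ge0 v; move: `|v|.
by case: k => //= -[a b]; rewrite lecE /= => /andP[/eqP -> _] ->.
Qed.

(** [Re] is multiplicative here because norms have zero imaginary part, which is extracted from
    their nonnegativity. *)
Lemma rnormZ (E : normedModType K) (a : K) (v : E) :
  rnorm (a *: v) = rnorm a * rnorm v.
Proof.
rewrite /rnorm normrZ; have := normr_ge0 v; have := normr_ge0 a.
move: `|a| `|v|; case: k => //= -[a1 a2] [b1 b2].
by rewrite !lecE /= => /andP[/eqP-> _] /andP[/eqP-> _]; rewrite mulr0 subr0.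
Qed.

Lemma rnormM (a b : K) : rnorm (a * b) = rnorm a * rnorm b.
Proof. exact: (@rnormZ K^o). Qed.

Lemma rnorm_real (r : R) : 0 <= r -> rnorm (real_scalar k r) = r.
Proof.
rewrite /rnorm; case: k => r0; first by rewrite ger0_norm.
by rewrite [`|_|]ger0_norm // lecE /= eqxx.
Qed.

Lemma ler_rnorm_sum (V : normedZmodType K) (n : nat) (F : 'I_n -> V) :
  rnorm (\sum_(j < n) F j) <= \sum_(j < n) rnorm (F j).
Proof.
elim/big_rec2: _ => [|j s v _ sv]; first by rewrite rnorm0.
by rewrite (le_trans (ler_rnormD _ _))// lerD2l.
Qed.

Lemma real_scalarB1 (r : R) : real_scalar k (1 - r) = 1 - real_scalar k r.
Proof. by case: k => //=; rewrite rmorphB. Qed.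

(** If [rnorm a] exceeds [c], shrink [a] radially to modulus [c]; the remainder then has modulus
    [rnorm a - c], and the bound amounts to [0 <= (rnorm a - 2 * c) ^+ 2]. *)
Lemma scalar_truncation (c : R) (a : K) : 0 <= c ->
  exists2 m : K, rnorm m <= c & 4 * c * rnorm (a - m) <= rnorm a ^+ 2.
Proof.
move=> c0; have [ac|ca] := leP (rnorm a) c.
  by exists a => //; rewrite subrr rnorm0 mulr0 sqr_ge0.
have a0 : 0 < rnorm a by exact: le_lt_trans ca.
have an0 : rnorm a != 0 by rewrite gt_eqF.
exists (real_scalar k (c / rnorm a) * a).
  by rewrite rnormM rnorm_real ?divr_ge0 ?rnorm_ge0// divfK.
have -> : a - real_scalar k (c / rnorm a) * a
        = real_scalar k (1 - c / rnorm a) * a.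
  by rewrite real_scalarB1 mulrBl mul1r.
rewrite rnormM rnorm_real; last by rewrite subr_ge0 ler_pdivrMr ?mul1r ?ltW.
rewrite mulrBl mul1r divfK//.
by have := sqr_ge0 (rnorm a - 2 * c); lra.
Qed.

Lemma rnorm_le_maxnorm (V : normedZmodType K) (n : nat) (x : 'I_n -> V) j :
  rnorm (x j) <= maxnorm x.
Proof. exact: le_bigmax. Qed.

Lemma maxnorm_le (V : normedZmodType K) (n : nat) (x : 'I_n -> V) (c : R) :
  0 <= c -> (forall j, rnorm (x j) <= c) -> maxnorm x <= c.
Proof. by move=> c0 xc; apply: bigmax_le. Qed.

Lemma maxnorm_ge0 (V : normedZmodType K) (n : nat) (x : 'I_n -> V) :
  0 <= maxnorm x.
Proof. exact: bigmax_ge_id. Qed.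

End RealNorm.

(** * Comparison of the hypo-norms and the max norm *)

Section HypoNorms.
Variables (R : realType) (k : scalar_kind).
Local Notation K := (scalar_field R k).
Variables (E : normedModType K) (n : nat) (x : 'I_n -> E).

(** Supplies the upper bound that makes both [sup]s genuine suprema: coefficients admissible for
    either norm have modulus at most 1. *)
Lemma rnorm_comb_le (l : 'I_n -> K) : (forall j, rnorm (l j) <= 1) ->
  rnorm (\sum_(j < n) l j *: x j) <= \sum_(j < n) rnorm (x j).
Proof.
move=> l1; rewrite (le_trans (ler_rnorm_sum _))//; apply: ler_sum => j _.
by rewrite rnormZ ler_piMl ?rnorm_ge0.
Qed.

Lemma hypo1_norm_ge (l : 'I_n -> K) : maxnorm l <= 1 ->
  rnorm (\sum_(j < n) l j *: x j) <= hypo1_norm x.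
Proof.
move=> l1; apply: ub_le_sup; last by exists l.
exists (\sum_(j < n) rnorm (x j)) => _ [m /= m1 <-].
by apply: rnorm_comb_le => j; apply: le_trans m1; exact: rnorm_le_maxnorm.
Qed.

Lemma hypoE_norm_ge (l : 'I_n -> K) : \sum_(j < n) rnorm (l j) ^+ 2 <= 1 ->
  rnorm (\sum_(j < n) l j *: x j) <= hypoE_norm x.
Proof.
move=> l1; apply: ub_le_sup; last by exists l.
exists (\sum_(j < n) rnorm (x j)) => _ [m /= m1 <-].
apply: rnorm_comb_le => j.
rewrite -(@expr_le1 _ 2) ?rnorm_ge0//; apply: le_trans m1.
by rewrite (bigD1 j)//= lerDl sumr_ge0// => i _; rewrite sqr_ge0.
Qed.

Lemma hypo1_norm_le (C : R) :
  (forall l : 'I_n -> K, maxnorm l <= 1 ->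
    rnorm (\sum_(j < n) l j *: x j) <= C) -> hypo1_norm x <= C.
Proof.
move=> leC; apply: ge_sup => [|_ [l /= l1 <-]]; last exact: leC.
(* Zero coefficients show that the set is nonempty. *)
by eexists; exists (fun=> 0) => //=; apply: maxnorm_le => // j; rewrite rnorm0.
Qed.

Lemma hypoE_norm_le (C : R) :
  (forall l : 'I_n -> K, \sum_(j < n) rnorm (l j) ^+ 2 <= 1 ->
    rnorm (\sum_(j < n) l j *: x j) <= C) -> hypoE_norm x <= C.
Proof.
move=> leC; apply: ge_sup => [|_ [l /= l1 <-]]; last exact: leC.
by eexists; exists (fun=> 0) => //=; rewrite big1// => j _; rewrite rnorm0 expr0n.
Qed.

Lemma hypo1_norm_ge0 : 0 <= hypo1_norm x.
Proof.
apply: le_trans (@hypo1_norm_ge (fun=> 0) _); first exact: rnorm_ge0.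
by apply: maxnorm_le => // j; rewrite rnorm0.
Qed.

Lemma hypoE_norm_ge0 : 0 <= hypoE_norm x.
Proof.
apply: le_trans (@hypoE_norm_ge (fun=> 0) _); first exact: rnorm_ge0.
by rewrite big1// => j _; rewrite rnorm0 expr0n.
Qed.

(** Each [x j] is the combination with Kronecker delta coefficients. This settles the degenerate
    case [hypo1_norm x = 0] of [hypoE_norm_sqr_le]. *)
Lemma maxnorm_le_hypo1 : maxnorm x <= hypo1_norm x.
Proof.
apply: maxnorm_le => [|j]; first exact: hypo1_norm_ge0.
have -> : x j = \sum_(i < n) real_scalar k ((i == j)%:R) *: x i.
  have s0 : real_scalar k (0 : R) = 0 by case: (k).
  have s1 : real_scalar k (1 : R) = 1 by case: (k).
  rewrite (bigD1 j)//= eqxx s1 scale1r big1 ?addr0// => i /negPf ->.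
  by rewrite s0 scale0r.
apply: hypo1_norm_ge; apply: maxnorm_le => // i.
by rewrite rnorm_real; case: (i == j).
Qed.

Lemma rnorm_comb_le_hypo1 (c : R) (l : 'I_n -> K) : 0 <= c ->
  (forall j, rnorm (l j) <= c) ->
  rnorm (\sum_(j < n) l j *: x j) <= c * hypo1_norm x.
Proof.
rewrite le_eqVlt => /predU1P[<- l0|c0 lc].
  (* For [c = 0] no rescaling is possible, but all coefficients vanish. *)
  rewrite mul0r big1 ?rnorm0// => j _.
  rewrite (@rnorm_eq0 _ _ _ (l j)) ?scale0r//.
  by apply/eqP; rewrite eq_le l0 rnorm_ge0.
have ci0 : 0 <= c^-1 by rewrite invr_ge0 ltW.
rewrite -ler_pdivrMl// -{1}(rnorm_real k ci0) -rnormZ scaler_sumr.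
under eq_bigr do rewrite scalerA.
apply: hypo1_norm_ge; apply: maxnorm_le => // j.
by rewrite rnormM rnorm_real// ler_pdivrMl// mulr1.
Qed.

Lemma hypo1_norm_le_hypoE : (0 < n)%N ->
  hypo1_norm x <= Num.sqrt n%:R * hypoE_norm x.
Proof.
move=> n0; have s0 : 0 < Num.sqrt (n%:R : R) by rewrite sqrtr_gt0 ltr0n.
have si0 : 0 <= (Num.sqrt (n%:R : R))^-1 by rewrite invr_ge0 ltW.
apply: hypo1_norm_le => l l1.
rewrite -ler_pdivrMl// -{1}(rnorm_real k si0) -rnormZ scaler_sumr.
under eq_bigr do rewrite scalerA.
apply: hypoE_norm_ge.
(* Each rescaled coefficient contributes at most [1 / n] to the sum of squares. *)
apply: (@le_trans _ _ (\sum_(j < n) (n%:R : R)^-1)); last first.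
  by rewrite sumr_const card_ord -[leLHS]mulr_natl divff// pnatr_eq0 -lt0n.
apply: ler_sum => j _.
rewrite rnormM rnorm_real// exprMn exprVn sqr_sqrtr ?ler0n//.
rewrite ler_piMr ?invr_ge0 ?ler0n// expr_le1 ?rnorm_ge0//.
exact: le_trans (rnorm_le_maxnorm _ _) l1.
Qed.

(** Truncate every coefficient at level [c]: the truncated part costs at most [c * hypo1_norm x],
    the remainder is measured by [maxnorm x]. Keeping the factor [4 * c] on the left avoids dividing
    by [c], which may be 0. *)
Lemma rnorm_comb_interpolation (c : R) (l : 'I_n -> K) : 0 <= c ->
  \sum_(j < n) rnorm (l j) ^+ 2 <= 1 ->
  4 * c * rnorm (\sum_(j < n) l j *: x j)
    <= 4 * c ^+ 2 * hypo1_norm x + maxnorm x.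
Proof.
move=> c0 l1.
have /choice[m m_spec] : forall j, exists a : K,
    rnorm a <= c /\ 4 * c * rnorm (l j - a) <= rnorm (l j) ^+ 2.
  by move=> j; have [a] := scalar_truncation (l j) c0; exists a.
have -> : \sum_(j < n) l j *: x j
        = \sum_(j < n) m j *: x j + \sum_(j < n) (l j - m j) *: x j.
  by rewrite -big_split/=; apply: eq_bigr => j _; rewrite -scalerDl addrC subrK.
have c40 : 0 <= 4 * c by rewrite mulr_ge0.
apply: le_trans (ler_wpM2l c40 (ler_rnormD _ _)) _.
have -> : 4 * c ^+ 2 * hypo1_norm x = 4 * c * (c * hypo1_norm x) by ring.
rewrite mulrDr lerD//.
  rewrite ler_wpM2l// rnorm_comb_le_hypo1// => j.
  by case: (m_spec j).
apply: le_trans (ler_wpM2l c40 (ler_rnorm_sum _)) _.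
apply: (@le_trans _ _ (\sum_(j < n) rnorm (l j) ^+ 2 * maxnorm x)); last first.
  by rewrite -mulr_suml ler_piMl ?maxnorm_ge0.
rewrite mulr_sumr; apply: ler_sum => j _; rewrite rnormZ mulrA.
rewrite ler_pM ?mulr_ge0 ?rnorm_ge0 ?rnorm_le_maxnorm//.
by case: (m_spec j).
Qed.

Lemma hypoE_norm_sqr_le : hypoE_norm x ^+ 2 <= hypo1_norm x * maxnorm x.
Proof.
have h0 := hypo1_norm_ge0; have M0 := maxnorm_ge0 x.
rewrite -[leRHS]sqr_sqrtr ?mulr_ge0// ler_sqr ?nnegrE ?hypoE_norm_ge0 ?sqrtr_ge0//.
(* With the bound in square-root form, the supremum is handled one combination at a time. *)
apply: hypoE_norm_le => l l1; rewrite -ler_sqr ?nnegrE ?rnorm_ge0 ?sqrtr_ge0//.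
rewrite sqr_sqrtr ?mulr_ge0//.
have key (c : R) (c0 : 0 <= c) := rnorm_comb_interpolation c0 l1.
move: key (rnorm_ge0 (\sum_(j < n) l j *: x j)) maxnorm_le_hypo1.
set N := rnorm _ => key N0 Mh.
have [h_eq0|h_neq0] := eqVneq (hypo1_norm x) 0.
  (* Here [maxnorm x] is 0 as well, so [c = 1] forces [N = 0]. *)
  have := key 1 ler01; rewrite h_eq0 in Mh *; nra.
have h_gt0 : 0 < hypo1_norm x by rewrite lt_def h_neq0.
move: key h_gt0; move: (hypo1_norm x) (maxnorm x) N N0 => h M N N0 key h_gt0.
have hn0 : h != 0 by rewrite gt_eqF.
(* This value of [c] maximizes [4 * c * N - 4 * c ^+ 2 * h], with maximum [N ^+ 2 / h]. *)
have c0 : 0 <= N / (2 * h) by rewrite divr_ge0 ?mulr_ge0 // ltW.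
have -> : N ^+ 2 = (4 * (N / (2 * h)) * N - 4 * (N / (2 * h)) ^+ 2 * h) * h.
  by field.
by rewrite mulrC ler_pM2l // lerBlDl key.
Qed.

End HypoNorms.

Theorem theorem4 (R : realType) (k : scalar_kind)
    (E : normedModType (scalar_field R k)) (n : nat) (hn : (1 <= n)%N)
    (x : 'I_n -> E) :
  [/\ 0 <= hypoE_norm x ^+ 2 - n%:R^-1 * hypo1_norm x ^+ 2
        <= 4^-1 * n%:R * maxnorm x ^+ 2,
      0 <= hypoE_norm x ^+ 2 - n%:R^-1 * hypo1_norm x ^+ 2
        <= hypo1_norm x * maxnorm x
    & 0 <= hypoE_norm x - (Num.sqrt n%:R)^-1 * hypo1_norm x
        <= 4^-1 * Num.sqrt n%:R * maxnorm x].
Proof.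
have s0 : 0 < Num.sqrt (n%:R : R) by rewrite sqrtr_gt0 ltr0n.
have nE : n%:R = Num.sqrt (n%:R : R) ^+ 2 by rewrite sqr_sqrtr ?ler0n.
move: (hypo1_norm_le_hypoE x hn) (hypoE_norm_sqr_le x).
move: (hypo1_norm_ge0 x) (hypoE_norm_ge0 x) (maxnorm_ge0 x).
rewrite [in n%:R^-1]nE [in 4^-1 * n%:R]nE; move: s0.
move: (Num.sqrt _) (hypo1_norm x) (hypoE_norm x) (maxnorm x).
move=> s h H M s0 h0 H0 M0 hsH HhM.
(* With [s] the square root of [n] and [q = h / s], all three claims follow from [q <= H] and
   [H ^+ 2 <= q * (s * M)]. *)
have [q hE] : exists q, h = s * q.
  by exists (s^-1 * h); rewrite mulVKf ?gt_eqF.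
have sn0 : s != 0 by rewrite gt_eqF.
have -> : (s ^+ 2)^-1 * h ^+ 2 = q ^+ 2 by rewrite hE; field.
have -> : s^-1 * h = q by rewrite hE mulKf.
have qH : q <= H by rewrite hE ler_pM2l in hsH.
have q0 : 0 <= q by move: h0; rewrite hE pmulr_rge0.
have s_ge0 : 0 <= s by exact: ltW.
have sM0 : 0 <= s * M by rewrite mulr_ge0.
have HqsM : H ^+ 2 <= q * (s * M) by move: HhM; rewrite hE; nra.
have lower : q ^+ 2 <= H ^+ 2 by rewrite ler_sqr.
split; rewrite !subr_ge0 ?lower ?qH /=.
(* AM-GM: [q * (s * M) - q ^+ 2 <= (s * M) ^+ 2 / 4]. *)
- by have := sqr_ge0 (q - s * M / 2); nra.
- by have := sqr_ge0 q; nra.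
(* After squaring, AM-GM again: [q * (s * M) <= (q + s * M / 4) ^+ 2], the difference being
   [(q - s * M / 4) ^+ 2]. *)
- rewrite lerBlDl -mulrA -ler_sqr ?nnegrE ?addr_ge0 ?mulr_ge0//.
  by have := sqr_ge0 (q - s * M / 4); nra.
Qed.
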